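(* There exist an absolute constant $C>0$ and a randomized online edge-coloring algorithm with the following guarantee. For all integers $n\ge 2$ and $\Delta\ge 1$, and for every adaptive adversary that reveals the edges of an $n$-vertex graph of maximum degree $\Delta$ one at a time, the algorithm (given $n$ and $\Delta$ in advance) always outputs a proper edge coloring, and with high probability in $n$ (i.e., with probability at least $1-1/n^{c}$ for some absolute constant $c>0$) it uses at most $$\Delta + C\,\Delta^{15/16}(\ln n)^{1/16}$$ distinct colors.
   Context: Online edge coloring: an unknown graph $G=(V,E)$ with $|V|=n$ and maximum degree $\Delta$ is given to the algorithm via $V$ and $\Delta$ in advance; edges are revealed one at a time, and upon arrival each edge must be immediately and irrevocably assigned a color so that edges sharing an endpoint receive distinct colors. An adaptive adversary chooses each next edge (subject to the final graph having maximum degree $\Delta$ on vertex set $V$) as a function of all previous random choices/outputs of the algorithm; the probability is over the algorithm's internal randomness. *)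

(* Defs.v *)
From HB Require Import structures.
From mathcomp Require Import all_boot all_order all_algebra.
From mathcomp Require Import reals.

Set Implicit Arguments.
Unset Strict Implicit.
Unset Printing Implicit Defensive.

Import Order.TTheory GRing.Theory Num.Theory.
Local Open Scope ring_scope.

Definition edge (n : nat) := {e : {set 'I_n} | #|e| == 2%N}.

Definition share_endpoint (n : nat) (e f : edge n) : bool :=
  val e :&: val f != set0.

Definition degree (n : nat) (E : seq (edge n)) (v : 'I_n) : nat :=
  count (fun e : edge n => v \in val e) E.

Definition max_degree (n : nat) (E : seq (edge n)) : nat :=
  \max_(v < n) degree E v.

(** One round of the game: the revealed edge, the random choice made by the
    algorithm in that round, and the color it output. *)
Definition round (n : nat) (coin : finType) : Type :=
  (edge n * coin * nat)%type.

Definition transcript (n : nat) (coin : finType) : Type :=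
  seq (round n coin).

(** In every round the algorithm makes a random choice in [coin], with a law that
    may depend on the past and on the arriving edge; the color of the edge is a
    function of the past, the edge and this choice. Edges of the past are never
    recolored, since colors are only recorded in the transcript. *)
Record online_algorithm (R : realType) (n : nat) := OnlineAlgorithm {
  coin : finType;
  law : transcript n coin -> edge n -> coin -> R;
  law_ge0 : forall t e r, 0 <= law t e r;
  law_sum1 : forall t e, \sum_(r : coin) law t e r = 1;
  color : transcript n coin -> edge n -> coin -> nat }.

(** The adversary sees all the past random choices and outputs; [None] means that
    all the edges have been revealed. *)
Definition adversary (R : realType) (n : nat) (A : online_algorithm R n) :=
  transcript n (coin A) -> option (edge n).

Definition edges (n : nat) (coin : finType) (t : transcript n coin) :
  seq (edge n) := [seq x.1.1 | x <- t].

Definition colors (n : nat) (coin : finType) (t : transcript n coin) :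
  seq nat := [seq x.2 | x <- t].

Definition extend (R : realType) (n : nat) (A : online_algorithm R n)
    (t : transcript n (coin A)) (e : edge n) (r : coin A) :
    transcript n (coin A) :=
  rcons t (e, r, color t e r).

(** The transcripts that occur with positive probability. *)
Inductive play (R : realType) (n : nat) (A : online_algorithm R n)
    (adv : adversary A) : transcript n (coin A) -> Prop :=
| play_nil : play adv [::]
| play_extend t e r : play adv t -> adv t = Some e -> 0 < law t e r ->
    play adv (extend t e r).

Definition complete_play (R : realType) (n : nat) (A : online_algorithm R n)
    (adv : adversary A) (t : transcript n (coin A)) : Prop :=
  play adv t /\ adv t = None.

(** Since no edge is revealed twice, a legal adversary stops after at most
    [#|edge n|] rounds. *)
Definition legal_adversary (R : realType) (n : nat) (A : online_algorithm R n)
    (Delta : nat) (adv : adversary A) : Prop :=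
  (forall t, play adv t -> uniq (edges t)) /\
  (forall t, complete_play adv t -> max_degree (edges t) = Delta).

Definition proper_coloring (n : nat) (coin : finType)
    (t : transcript n coin) : Prop :=
  forall x y : round n coin, x \in t -> y \in t ->
    x.1.1 != y.1.1 -> share_endpoint x.1.1 y.1.1 -> x.2 != y.2.

Definition num_colors (n : nat) (coin : finType) (t : transcript n coin) : nat :=
  size (undup (colors t)).

(** The probability that the transcript satisfies [E] when the game is continued
    from [t] for at most [k] further rounds. *)
Fixpoint prob_from (R : realType) (n : nat) (A : online_algorithm R n)
    (adv : adversary A) (E : pred (transcript n (coin A)))
    (k : nat) (t : transcript n (coin A)) : R :=
  if k is k'.+1 then
    if adv t is Some e then
      \sum_(r : coin A) law t e r * prob_from adv E k' (extend t e r)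
    else (E t)%:R
  else (E t)%:R.

(** For a legal adversary the game is over after [#|edge n|] rounds, so this is
    the probability that the final transcript satisfies [E]. *)
Definition prob (R : realType) (n : nat) (A : online_algorithm R n)
    (adv : adversary A) (E : pred (transcript n (coin A))) : R :=
  prob_from adv E #|{: edge n}| [::].

(* Main.v *)
Require Import Defs.
From HB Require Import structures.
From mathcomp Require Import all_boot all_order all_algebra.
From mathcomp Require Import reals sequences exp.
From mathcomp Require Import ring lra.

Set Implicit Arguments.
Unset Strict Implicit.
Unset Printing Implicit Defensive.

Import Order.TTheory GRing.Theory Num.Theory.
Local Open Scope ring_scope.

(** Every vertex [v] and main color [c] carry a weight [S v c], initially [1].
    A random algorithm would give color [c] to the arriving edge [uv] with
    probability [p c = a * S u c * S v c], where [a = (1 - eps) / Delta]; the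
    weights of [c] at [u] and [v] then become [0] if [c] is chosen and are
    divided by [1 - p c] otherwise, so each weight is a martingale. While it is
    positive, [1 / S v c = 1 - a * \sum_u S u c], the sum being over the past
    neighbors [u] of [v] with [S u c] taken at the arrival of [uv]. For fixed
    sets [U] of vertices and [K] of colors these weights sum over [U] and [K] to
    a martingale, and a union bound over all the pairs [(U, K)] copes with the
    adaptive choice of the neighbors: at each vertex, all but
    [eps ^ 3 * Delta / 32] colors keep a weight at most [2 / eps], so that
    discarding the heavy colors costs little. As [\sum_c S u c * S v c] also
    stays close to [Delta], every edge receives a main color with probability
    at least [1 - 4 eps], and at most [7 eps Delta] edges at each vertex are
    left; they are colored greedily with [14 eps Delta + 1] spare colors.

    The exponential moments used in the concentration bounds add up to a
    potential whose conditional expectation never increases. Always choosing an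
    outcome of least potential therefore gives a deterministic algorithm that
    satisfies all the bounds against every adversary. With
    [eps = 4 (ln n / Delta) ^ (1 / 16)] all the union bounds are affordable. *)

(** * Exponential moments *)

(** Since [1 - x <= expR (- x)], it suffices that [(1 - x) * (1 + x + 2 * x ^+ 2) = 1 + x ^+ 2 * (1
    - 2 * x)] is at least [1]. *)
Lemma expR_le_quadratic (R : realType) (x : R) :
  `|x| <= 1 / 2 -> expR x <= 1 + x + 2 * x ^+ 2.
Proof.
rewrite ler_norml => /andP[x1 x2].
have Hx : (1 - x) * expR x <= 1.
  rewrite -[leRHS](mulVf (lt0r_neq0 (expR_gt0 x))) ler_wpM2r ?expR_ge0 // -expRN.
  exact: expR_ge1Dx.
have x3 : 0 < 1 - x by lra.
rewrite -(ler_pM2l x3); apply: (le_trans Hx).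
have -> : (1 - x) * (1 + x + 2 * x ^+ 2) = 1 + x ^+ 2 * (1 - 2 * x) by ring.
by rewrite lerDl mulr_ge0 ?sqr_ge0 //; lra.
Qed.

Section Mean.
Variables (R : realType) (D : nat) (p : 'I_D -> R).
Hypothesis p_ge0 : forall c, 0 <= p c.
Hypothesis p_le : forall c, p c <= 1 / 2.
Hypothesis p_sum : \sum_c p c <= 1.

(** Expectation over the outcome of one round; the mass missing from [p] is that of [None]. *)
Definition mean (x : option 'I_D -> R) : R :=
  (1 - \sum_c p c) * x None + \sum_c p c * x (Some c).

Lemma mean_le (x y : option 'I_D -> R) :
  (forall o, x o <= y o) -> mean x <= mean y.
Proof.
move=> xy; apply: lerD; first by rewrite ler_wpM2l // subr_ge0.
by apply: ler_sum => c _; rewrite ler_wpM2l.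
Qed.

Lemma meanZ k (x : option 'I_D -> R) : mean (fun o => k * x o) = k * mean x.
Proof.
rewrite /mean mulrDr mulrCA; congr (_ + _).
by rewrite mulr_sumr; apply: eq_bigr => c _; rewrite mulrCA.
Qed.

Lemma mean_sum (I : finType) (P : pred I) (x : I -> option 'I_D -> R) :
  mean (fun o => \sum_(i | P i) x i o) = \sum_(i | P i) mean (x i).
Proof.
rewrite /mean big_split /= mulr_sumr; congr (_ + _).
by rewrite exchange_big /=; apply: eq_bigr => c _; rewrite mulr_sumr.
Qed.

Lemma meanD (x y : option 'I_D -> R) :
  mean (fun o => x o + y o) = mean x + mean y.
Proof.
rewrite /mean mulrDr addrACA -big_split /=; congr (_ + _).
by apply: eq_bigr => c _; rewrite mulrDr.
Qed.

Lemma mean_cst k : mean (fun=> k) = k.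
Proof. by rewrite /mean -mulr_suml -mulrDl subrK mul1r. Qed.

(** In the quadratic bound on [expR] the linear term has nonpositive mean, so only [2 * theta ^+ 2]
    is left. *)
Lemma mean_expR_le (x : option 'I_D -> R) theta :
  (forall o, `|x o| <= theta) -> theta <= 1 / 2 -> mean x <= 0 ->
  mean (fun o => expR (x o)) <= expR (2 * theta ^+ 2).
Proof.
move=> xt t2 mx.
apply: (@le_trans _ _ (mean (fun o => (1 + 2 * theta ^+ 2) + x o))).
  apply: mean_le => o; apply: (le_trans (expR_le_quadratic _)).
    exact: le_trans (xt o) t2.
  have : x o ^+ 2 <= theta ^+ 2.
    by rewrite -[x o ^+ 2]ger0_norm ?sqr_ge0 // normrX lerXn2r ?nnegrE ?normr_ge0 //
       (le_trans _ (xt o)).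
  lra.
rewrite meanD mean_cst; apply: le_trans (expR_ge1Dx _); lra.
Qed.

(** The relative change of the weight of color [c] at an endpoint of the
    arriving edge when the outcome of the round is [o]. *)
Definition change (c : 'I_D) (o : option 'I_D) : R :=
  if o == Some c then -1 else p c / (1 - p c).

Lemma mean_change c : mean (change c) = 0.
Proof.
have pn : 1 - p c != 0 by have := p_le c; lra.
have E o : change c o = p c / (1 - p c) + (- (1 - p c)^-1) * (o == Some c)%:R.
  rewrite /change; case: (o == Some c); rewrite ?mulr0 ?addr0 //.
  by rewrite mulr1; field.
rewrite /mean !E mulr0 addr0.
under [X in _ + X]eq_bigr do rewrite E mulrDr.
rewrite big_split /= -mulr_suml addrA -mulrDl subrK mul1r.
rewrite (bigD1 c) //= eqxx mulr1 big1 => [|i ic]; last first.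
  by rewrite (inj_eq Some_inj) (negbTE ic) !mulr0.
by field.
Qed.

(** The chosen color contributes [1], every other one at most [2 * p c]. The bound does not grow
    with the number of colors. *)
Lemma sum_norm_change o : \sum_c `|change c o| <= 3.
Proof.
apply: (@le_trans _ _ (\sum_c (2 * p c + (o == Some c)%:R))).
  apply: ler_sum => c _; rewrite /change; have := p_ge0 c; have := p_le c.
  case: (o == Some c) => p1 p0; first by rewrite normrN1 lerDr mulr_ge0.
  rewrite addr0 ger0_norm; last by apply: divr_ge0 => //; lra.
  rewrite ler_pdivrMr; last by lra.
  nra.
rewrite big_split /= -mulr_sumr.
have : \sum_c ((o == Some c)%:R : R) <= 1.
  case: o => [c|]; last by rewrite big1.
  rewrite (bigD1 c) //= eqxx big1 ?addr0 // => i ic.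
  by rewrite (inj_eq Some_inj) eq_sym (negbTE ic).
by have := p_sum; lra.
Qed.

(** The exponent has mean zero and, by [sum_norm_change], absolute value at most
    [3 * gamma <= 1 / 2]. *)
Lemma mean_expR_change (g : 'I_D -> R) gamma :
  0 <= gamma -> (forall c, `|g c| <= gamma) -> 6 * gamma <= 1 ->
  mean (fun o => expR (\sum_c g c * change c o)) <= expR (18 * gamma ^+ 2).
Proof.
move=> gamma0 gg g1.
have -> : 18 * gamma ^+ 2 = 2 * (3 * gamma) ^+ 2 by ring.
apply: mean_expR_le.
- move=> o; apply: (le_trans (ler_norm_sum _ _ _)).
  apply: (@le_trans _ _ (\sum_c gamma * `|change c o|)).
    by apply: ler_sum => c _; rewrite normrM ler_wpM2r.
  by rewrite -mulr_sumr mulrC ler_wpM2r // sum_norm_change.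
- lra.
- rewrite mean_sum big1 // => c _; by rewrite meanZ mean_change mulr0.
Qed.

(** The step of the method of conditional expectations: a minimum over [None] and the colors of
    nonzero probability is at most the mean. *)
Lemma le_mean (x : option 'I_D -> R) m :
  x None >= m -> (forall c, p c != 0 -> m <= x (Some c)) -> m <= mean x.
Proof.
move=> x0 xc; rewrite -[leLHS]mean_cst; apply: lerD.
  by rewrite ler_wpM2l // subr_ge0.
apply: ler_sum => c _; have [->|/xc mx] := eqVneq (p c) 0; first by rewrite !mul0r.
by rewrite ler_wpM2l.
Qed.

End Mean.

(** * Weights *)

(** The most recent round comes first; [None] is the outcome of a round whose
    edge does not receive one of the [D] main colors. *)
Definition history (n D : nat) := seq ({set 'I_n} * option 'I_D).

Definition valid_history n D (h : history n D) : bool :=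
  all (fun x : {set 'I_n} * option 'I_D => #|x.1| == 2%N) h.

Definition hdeg n D (h : history n D) (v : 'I_n) : nat :=
  count (fun x : {set 'I_n} * option 'I_D => v \in x.1) h.

Definition hoverflow n D (h : history n D) (v : 'I_n) : nat :=
  count (fun x : {set 'I_n} * option 'I_D => (v \in x.1) && (x.2 == None)) h.

Definition arrived n D (h : history n D) (v u : 'I_n) : bool :=
  [set v; u] \in [seq x.1 | x <- h].

Definition neighbors n D (h : history n D) (v : 'I_n) : {set 'I_n} :=
  [set u | (u != v) && arrived h v u].

Section Weights.
Variables (R : realType) (n D : nat) (a B : R).
Implicit Types (h : history n D) (e : {set 'I_n}) (o : option 'I_D).
Implicit Types (u v w : 'I_n) (c : 'I_D).

(* A color whose weight at [v] exceeds [B] is never used at [v] again. *)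
Definition capped (x : R) : R := if x <= B then x else 0.

(** [weight h v c] is the inverse of the conditional probability that [c] is
    still free at [v], and [0] once [c] is used at [v]. *)
Fixpoint weight h v c : R :=
  if h is (e, o) :: h' then
    if v \in e then
      if o == Some c then 0
      else weight h' v c / (1 - a * \prod_(w in e) capped (weight h' w c))
    else weight h' v c
  else 1.

Definition pr h e c : R := a * \prod_(w in e) capped (weight h w c).

(** The weight of [c] at [u], stopped when the edge [vu] arrives. *)
Fixpoint stopped h v u c : R :=
  if h is _ :: h' then
    if arrived h v u then stopped h' v u c else weight h u c
  else 1.

Hypothesis a_ge0 : 0 <= a.
Hypothesis B_ge1 : 1 <= B.
Hypothesis aB2 : 2 * a * B ^+ 2 <= 1.

Lemma capped_le x : capped x <= B.
Proof. by rewrite /capped; case: ifP => // _; exact: le_trans ler01 B_ge1. Qed.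

Lemma capped_ge0 x : 0 <= x -> 0 <= capped x.
Proof. by rewrite /capped; case: ifP. Qed.

Lemma capped_id x : 0 <= x -> capped x <= x.
Proof. by rewrite /capped; case: ifP. Qed.

Lemma pr_pair h u v c : u != v ->
  pr h [set u; v] c = a * (capped (weight h u c) * capped (weight h v c)).
Proof. by move=> uv; rewrite /pr big_setU1 ?inE //= big_set1. Qed.

Lemma pr_bounds h e c : #|e| = 2%N -> (forall v, 0 <= weight h v c) ->
  0 <= pr h e c <= 1 / 2.
Proof.
move=> /eqP/cards2P[u [v [uv ->]]] w0; rewrite pr_pair //.
have u0 := capped_ge0 (w0 u); have v0 := capped_ge0 (w0 v).
have uB := capped_le (weight h u c); have vB := capped_le (weight h v c).
rewrite !mulr_ge0 //=.
apply: (@le_trans _ _ (a * (B * B))); last by move: aB2; rewrite expr2; lra.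
by rewrite ler_wpM2l // ler_pM.
Qed.

(** A weight at most [B] at most doubles, as [pr <= 1 / 2]; one above [B] is capped to [0], which
    makes [pr] vanish and freezes it. *)
Lemma weight_bounds h v c : valid_history h -> 0 <= weight h v c <= 2 * B.
Proof.
elim: h v => [|[e o] h IH] v /=; first by move=> _; apply/andP; split; move: B_ge1; lra.
case/andP=> /eqP e2 /IH{}IH.
case: (boolP (v \in e)) => ve; last exact: IH.
have /andP[p0 p2] := pr_bounds e2 (fun v => proj1 (andP (IH v))).
case: (o == Some c); first by rewrite lexx /=; move: B_ge1; lra.
have /andP[w0 w2] := IH v.
rewrite -/(pr h e c) divr_ge0 /=; [|by []|by lra].
rewrite ler_pdivrMr; last by lra.
have [wB|wB] := leP (weight h v c) B; first by nra.
suff -> : pr h e c = 0 by lra.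
by rewrite /pr (bigD1 v) //= {1}/capped leNgt wB mul0r mulr0.
Qed.

Lemma pr_ge0 h e c : valid_history h -> #|e| = 2%N -> 0 <= pr h e c.
Proof.
by move=> vh e2; have /andP[] :=
  pr_bounds e2 (fun v => proj1 (andP (weight_bounds v c vh))).
Qed.

Lemma pr_le h e c : valid_history h -> #|e| = 2%N -> pr h e c <= 1 / 2.
Proof.
by move=> vh e2; have /andP[] :=
  pr_bounds e2 (fun v => proj1 (andP (weight_bounds v c vh))).
Qed.

Lemma weight_step h e o u c : valid_history h -> #|e| = 2%N ->
  weight ((e, o) :: h) u c =
  weight h u c + (u \in e)%:R * (weight h u c * change (pr h e) c o).
Proof.
move=> vh e2 /=; case: (u \in e); last by rewrite mul0r addr0.
rewrite mul1r /change -/(pr h e c); case: (o == Some c); first by rewrite mulrN1 subrr.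
have := pr_le c vh e2; set p := pr h e c => p2.
have p1 : 1 - p != 0 by clear -p2; lra.
by field.
Qed.

Lemma arrived_cons h e o v u :
  arrived ((e, o) :: h) v u = ([set v; u] == e) || arrived h v u.
Proof. by rewrite /arrived inE. Qed.

Lemma stopped_weight h v u c :
  ~~ arrived h v u -> stopped h v u c = weight h u c.
Proof. by case: h => [|x h] //= /negbTE ->. Qed.

(** The indicator looks at the new history, because the round that reveals [vu] itself must not move
    the stopped weight. *)
Lemma stopped_step h e o v u c : valid_history h -> #|e| = 2%N ->
  stopped ((e, o) :: h) v u c = stopped h v u c +
    ((u \in e) && ~~ arrived ((e, o) :: h) v u)%:R *
      (weight h u c * change (pr h e) c o).
Proof.
move=> vh e2; have [ar|nar] := boolP (arrived ((e, o) :: h) v u).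
  by rewrite /stopped -/stopped ar andbF mul0r addr0.
rewrite stopped_weight // weight_step // andbT stopped_weight //.
by apply: contra nar; rewrite arrived_cons => ->; rewrite orbT.
Qed.

(* The bound would be an equality for a color that is free at [v] and whose
   weights were never capped off. *)
Lemma weight_neighbors h v c : valid_history h -> uniq [seq x.1 | x <- h] ->
  weight h v c * (1 - a * \sum_(u in neighbors h v) stopped h v u c) <= 1.
Proof.
elim: h => [_ _|[e o] h IH vh' /andP[eh un]].
  rewrite big1 ?mulr0 ?subr0 ?mulr1 // => u.
  by rewrite inE => /andP[].
have /andP[/eqP e2 vh] := vh'.
have {}IH := IH vh un.
have [ve|ve] := boolP (v \in e); last first.
  have -> : weight ((e, o) :: h) v c = weight h v c.
    by rewrite weight_step // (negbTE ve) mul0r addr0.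
  have E u : arrived ((e, o) :: h) v u = arrived h v u.
    rewrite arrived_cons; case: eqP => // eE.
    by move: ve; rewrite -eE !inE eqxx.
  rewrite (eq_big (mem (neighbors h v)) (fun u => stopped h v u c)) // => u.
    by rewrite /= !inE E.
  by rewrite inE => /andP[_ ar]; rewrite /stopped -/stopped ar.
have [u uv eE] : exists2 u, u != v & e = [set v; u].
  have /cards2P[x [y [xy eE]]] : #|e| == 2%N by rewrite e2.
  move: ve; rewrite eE !inE => /orP[] /eqP ->; first by exists y; rewrite // eq_sym.
  by exists x; rewrite // setUC.
have nar : ~~ arrived h v u by rewrite /arrived -eE.
have -> : neighbors ((e, o) :: h) v = u |: neighbors h v.
  apply/setP => x; rewrite !inE arrived_cons eE.
  have [->|xu] := eqVneq x u; first by rewrite eqxx uv.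
  have [->|xv] //= := eqVneq x v.
  suff /negbTE -> : [set v; x] != [set v; u] by [].
  apply: contra xu => /eqP/setP/(_ x); rewrite !inE eqxx orbT (negbTE xv) /=.
  by move=> <-.
rewrite big_setU1; last by rewrite inE (negbTE nar) andbF.
have st x : x \in u |: neighbors h v ->
    stopped ((e, o) :: h) v x c = stopped h v x c.
  move=> xN; suff ar : arrived ((e, o) :: h) v x by rewrite /stopped -/stopped ar.
  move: xN; rewrite !inE arrived_cons eE => /orP[/eqP ->|/andP[_ ->]].
    by rewrite eqxx.
  by rewrite orbT.
rewrite (st u) ?setU11 // stopped_weight //.
rewrite (eq_bigr (fun x => stopped h v x c)); last by move=> x xN; rewrite st // setU1r.
have p2 := pr_le c vh e2; have p0 := pr_ge0 c vh e2.
have /andP[wv0 _] := weight_bounds v c vh; have /andP[wu0 _] := weight_bounds u c vh.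
(* Capping only lowers [pr]. The new neighbor [u] thus takes at least [pr h e c] off the left-hand
   side of the induction hypothesis, which pays for the division by [1 - pr h e c]. *)
have pE : pr h e c <= a * (weight h v c * weight h u c).
  rewrite eE pr_pair 1?eq_sym // ler_wpM2l //.
  by rewrite ler_pM ?capped_ge0 ?capped_id.
rewrite {1}/weight -/weight ve -/(pr h e c); case: (o == Some c); first by rewrite mul0r ler01.
move: IH pE p2 p0 wv0 wu0; move: (\sum_(_ in _) _) (weight _ _ _) (weight _ _ _) (pr _ _ _).
clear; move=> s x y p IH pE p2 p0 x0 y0.
rewrite mulrAC ler_pdivrMr; last by lra.
by rewrite mul1r /=; lra.
Qed.

Lemma weight_used h e v c : (e, Some c) \in h -> v \in e -> weight h v c = 0.
Proof.
elim: h => [|[f o] h IH] //; rewrite inE => /orP[/eqP[<- <-]|ih] ve /=.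
  by rewrite ve eqxx.
by rewrite IH //; case: ifP => // _; case: ifP => // _; rewrite mul0r.
Qed.

(** The source of properness: a color already used at an endpoint has probability zero. *)
Lemma pr_used h e f v c :
  (f, Some c) \in h -> v \in f -> v \in e -> pr h e c = 0.
Proof.
move=> fh vf ve; rewrite /pr (bigD1 v) //= (weight_used fh vf) /capped.
by rewrite if_same mul0r mulr0.
Qed.

End Weights.

(** * The potential *)

Lemma hdeg_cons n D (h : history n D) e o v :
  hdeg ((e, o) :: h) v = ((v \in e) + hdeg h v)%N.
Proof. by []. Qed.

Section Potential.
Variables (R : realType) (n D : nat) (a B lam eps L : R).
Implicit Types (h : history n D) (e : {set 'I_n}) (o : option 'I_D).
Implicit Types (u v w : 'I_n) (c : 'I_D) (U : {set 'I_n}) (K : {set 'I_D}).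

Notation weight := (weight a B).
Notation stopped := (stopped a B).
Notation pr := (pr a B).

(** The bound of [mean_expR_change] for coefficients up to [lam * (2 * B) ^+ 2]; each incidence of
    an edge with a relevant vertex is charged this much. *)
Definition tau : R := 18 * (4 * lam * B ^+ 2) ^+ 2.

(** The sign [s] selects the upper or the lower deviation. Only edges at [u] or [v] move the sum,
    hence the degrees in the charge. *)
Definition pair_exponent (s : bool) u v h : R :=
  (-1) ^+ s * lam * (\sum_c stopped h v u c * stopped h u v c - D%:R)
  - tau * (hdeg h u + hdeg h v)%:R.

Definition star_exponent v U K h : R :=
  lam * (\sum_(c in K) \sum_(u in U) (stopped h v u c - 1))
  - tau * (\sum_(u in U) hdeg h u)%:R.

Definition overflow_exponent v h : R :=
  eps * ((hoverflow h v)%:R - 4 * eps * (hdeg h v)%:R)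
  - 2 * eps ^+ 2 * (hdeg h v)%:R.

(** The factor [expR (- #|U| L - D)] with [L = ln n] pays for the union bound
    over all the sets [U] and [K]. *)
Definition potential h : R :=
  \sum_(s : bool) \sum_u \sum_(v | u != v) expR (pair_exponent s u v h) +
  \sum_v \sum_(U : {set 'I_n}) \sum_(K : {set 'I_D})
    expR (- (#|U|%:R * L) - D%:R) * expR (star_exponent v U K h) +
  \sum_v expR (overflow_exponent v h).

Hypothesis a_ge0 : 0 <= a.
Hypothesis B_ge1 : 1 <= B.
Hypothesis aB2 : 2 * a * B ^+ 2 <= 1.
Hypothesis lam_ge0 : 0 <= lam.
Hypothesis lamB : 24 * lam * B ^+ 2 <= 1.

Section Step.
Variables (h : history n D) (e : {set 'I_n}).
Hypothesis h_valid : valid_history h.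
Hypothesis e2 : #|e| = 2%N.
Hypothesis pr_sum : \sum_c pr h e c <= 1.

Let p0 c : 0 <= pr h e c := pr_ge0 a_ge0 B_ge1 aB2 c h_valid e2.
Let p2 c : pr h e c <= 1 / 2 := pr_le a_ge0 B_ge1 aB2 c h_valid e2.
Let w0 u c : 0 <= weight h u c.
Proof. by have /andP[] := weight_bounds a_ge0 B_ge1 aB2 u c h_valid. Qed.
Let w2 u c : weight h u c <= 2 * B.
Proof. by have /andP[] := weight_bounds a_ge0 B_ge1 aB2 u c h_valid. Qed.

Let gamma0 : 0 <= 4 * lam * B ^+ 2.
Proof. by apply: mulr_ge0; [rewrite mulr_ge0|exact: sqr_ge0]. Qed.

(** Here [j] counts the charged incidences of the round: if there is none the exponent stands still,
    otherwise a single [tau] covers the exponential moment. *)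
Lemma mean_expR_drift (X : R) (Y : option 'I_D -> R) (g : 'I_D -> R) (j : nat) :
  (forall o, Y o = X + \sum_c g c * change (pr h e) c o - tau * j%:R) ->
  (if j == 0%N then forall c, g c = 0
   else forall c, `|g c| <= 4 * lam * B ^+ 2) ->
  mean (pr h e) (fun o => expR (Y o)) <= expR X.
Proof.
move=> EY gb.
have -> : mean (pr h e) (fun o => expR (Y o)) = expR (X - tau * j%:R) *
    mean (pr h e) (fun o => expR (\sum_c g c * change (pr h e) c o)).
  rewrite -meanZ /mean; congr (_ * _ + _); first by rewrite -expRD EY addrAC.
  by apply: eq_bigr => c _; rewrite -expRD EY addrAC.
case: (posnP j) gb => [-> /= g0|j0 gb].
  rewrite mulr0 subr0 -[leRHS]mulr1 ler_wpM2l ?expR_ge0 //.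
  rewrite -[leRHS](@mean_cst _ _ (pr h e)); apply: mean_le => // o.
  by rewrite big1 ?expR0 // => c _; rewrite g0 mul0r.
apply: (@le_trans _ _ (expR (X - tau * j%:R) * expR tau)).
  rewrite ler_wpM2l ?expR_ge0 // mean_expR_change //; move: lamB; lra.
rewrite -expRD ler_expR -addrA gerDl addrC subr_le0 ler_peMr //.
  by rewrite /tau mulr_ge0 // sqr_ge0.
by rewrite ler1n.
Qed.

(** Unless the pair has arrived by the end of the round, [e] contains at most one of [u] and [v], so
    the products of weights change linearly in [change]. *)
Lemma mean_pair s u v : u != v ->
  mean (pr h e) (fun o => expR (pair_exponent s u v ((e, o) :: h)))
  <= expR (pair_exponent s u v h).
Proof.
move=> uv; pose ar := ([set v; u] == e) || arrived h v u.
have arE o : arrived ((e, o) :: h) v u = ar by rewrite arrived_cons.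
have arE' o : arrived ((e, o) :: h) u v = ar.
  by rewrite -(arE o) /arrived setUC.
pose g c := if ar then 0 else ((u \in e) || (v \in e))%:R *
   ((-1) ^+ s * lam * (weight h v c * weight h u c)).
apply: (@mean_expR_drift _ _ g ((u \in e) + (v \in e))) => [o|].
  rewrite /pair_exponent !hdeg_cons addnACA (natrD _ (_ + _)).
  have -> : \sum_c stopped ((e, o) :: h) v u c * stopped ((e, o) :: h) u v c =
    \sum_c stopped h v u c * stopped h u v c + \sum_c
      (if ar then 0 else ((u \in e) || (v \in e))%:R *
      (weight h v c * weight h u c)) * change (pr h e) c o.
    rewrite -big_split; apply: eq_bigr => c _.
    rewrite !stopped_step // arE arE' /=; case: (boolP ar) => [_|nar].
      by rewrite !andbF !mul0r !addr0.
    have nar1 : ~~ arrived h v u by apply: contra nar; rewrite /ar => ->; rewrite orbT.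
    have nar2 : ~~ arrived h u v by rewrite /arrived setUC.
    rewrite !stopped_weight // !andbT.
    have : ~~ ((u \in e) && (v \in e)).
      apply: contra nar => /andP[ue ve]; apply/orP; left.
      by rewrite eqEcard e2 cards2 eq_sym uv subUset !sub1set ue ve.
    by case: (u \in e); case: (v \in e) => //= _; ring.
  set T := (X in _ + X - D%:R).
  have -> : \sum_c g c * change (pr h e) c o = (-1) ^+ s * lam * T.
    rewrite /T mulr_sumr; apply: eq_bigr => c _.
    rewrite /g; case: (boolP ar) => _; first by rewrite !mul0r mulr0.
    by rewrite [_%:R * (_ * _ * _)]mulrCA -[in LHS]mulrA.
  by move: (\sum_c _) T (_ * lam) (_ + _)%:R (_ + _)%:R => *; ring.
have gb c : `|g c| <= 4 * lam * B ^+ 2.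
  rewrite /g; case: (boolP ar) => _; first by rewrite normr0.
  rewrite 3!normrM normr_sign mul1r [`|lam|]ger0_norm // normr_nat.
  rewrite [leRHS](_ : _ = 1 * (lam * (2 * B * (2 * B)))); last by ring.
  rewrite ler_pM //; first by rewrite mulr_ge0.
    by case: (_ || _).
  by rewrite ler_wpM2l // ger0_norm ?mulr_ge0 // ler_pM.
case: eqP => // /eqP; rewrite addn_eq0 => /andP[u0 v0] c.
by rewrite /g; move: u0 v0; case: (u \in e); case: (v \in e) => // _ _; rewrite mul0r if_same.
Qed.

(** Only the two endpoints of [e] can contribute, so each coefficient is at most [lam * (4 * B)],
    which is below [4 * lam * B ^+ 2]. *)
Lemma mean_star v U K :
  mean (pr h e) (fun o => expR (star_exponent v U K ((e, o) :: h)))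
  <= expR (star_exponent v U K h).
Proof.
pose i u := (u \in e) && ~~ (([set v; u] == e) || arrived h v u).
pose g c := lam * ((c \in K)%:R * \sum_(u in U) (i u)%:R * weight h u c).
apply: (@mean_expR_drift _ _ g (\sum_(u in U) (u \in e))) => [o|].
  rewrite /star_exponent.
  have -> : (\sum_(u in U) hdeg ((e, o) :: h) u)%:R =
      (\sum_(u in U) (u \in e))%:R + (\sum_(u in U) hdeg h u)%:R :> R.
    by rewrite -natrD -big_split.
  have -> : \sum_(c in K) \sum_(u in U) (stopped ((e, o) :: h) v u c - 1) =
      \sum_(c in K) \sum_(u in U) (stopped h v u c - 1) + \sum_c (c \in K)%:R *
      (\sum_(u in U) (i u)%:R * weight h u c) * change (pr h e) c o; last first.
    rewrite /g; under [X in _ = _ + X - _]eq_bigr do rewrite -mulrA.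
    by rewrite -mulr_sumr; move: (\sum_c _) => ?; ring.
  have -> : \sum_c (c \in K)%:R * (\sum_(u in U) (i u)%:R * weight h u c) *
      change (pr h e) c o = \sum_(c in K) (\sum_(u in U) (i u)%:R * weight h u c) *
      change (pr h e) c o.
    rewrite [RHS]big_mkcond; apply: eq_bigr => c _.
    by case: (c \in K); rewrite ?mul1r ?mul0r.
  rewrite -big_split; apply: eq_bigr => c _.
  rewrite [RHS]/= mulr_suml -big_split; apply: eq_bigr => u _.
  rewrite stopped_step // arrived_cons -/(i u) /=; ring.
have gb c : `|g c| <= 4 * lam * B ^+ 2.
  rewrite /g !normrM [`|lam|]ger0_norm // normr_nat.
  have s0 : 0 <= \sum_(u in U) (i u)%:R * weight h u c.
    by apply: sumr_ge0 => u _; rewrite mulr_ge0.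
  rewrite [X in _ * (_ * X)]ger0_norm //.
  rewrite [leRHS](_ : _ = lam * (1 * (4 * B ^+ 2))); last by ring.
  rewrite ler_wpM2l // ler_pM //; first by case: (_ \in _).
  apply: (@le_trans _ _ (\sum_(u in e) 2 * B)).
    rewrite [leLHS](bigID (mem e)) /= [X in _ + X]big1 ?addr0; last first.
      by move=> u /andP[_ /negbTE ue]; rewrite /i ue mul0r.
    rewrite [leRHS](bigID (mem U)) /=; apply: ler_wpDr.
      by apply: sumr_ge0 => u _; move: B_ge1; lra.
    under [leRHS]eq_bigl do rewrite andbC.
    apply: ler_sum => u _; rewrite -[leRHS]mul1r ler_pM //.
    by case: (i u).
  rewrite sumr_const e2 -mulr_natl; move: B_ge1; nra.
case: eqP => // /eqP; rewrite sum_nat_eq0 => /forall_inP Ue c.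
rewrite /g big1 ?mulr0 // => u /Ue; rewrite /i; case: (u \in e) => //= _.
by rewrite mul0r.
Qed.

(** At an endpoint of [e] the outcome [None] has probability at most [4 * eps], so the increment has
    nonpositive mean and [mean_expR_le] applies with [theta = eps]. *)
Lemma mean_overflow v : 0 <= eps -> 4 * eps <= 1 ->
  1 - 4 * eps <= \sum_c pr h e c ->
  mean (pr h e) (fun o => expR (overflow_exponent v ((e, o) :: h)))
  <= expR (overflow_exponent v h).
Proof.
move=> eps0 eps1 ps.
have [ve|ve] := boolP (v \in e); last first.
  rewrite le_eqVlt; apply/orP; left; apply/eqP.
  rewrite -[RHS](@mean_cst _ _ (pr h e)) /mean /overflow_exponent /hoverflow /hdeg /=.
  by rewrite (negbTE ve).
pose x o := eps * ((o == None)%:R - 4 * eps).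
have E o : expR (overflow_exponent v ((e, o) :: h)) =
    expR (overflow_exponent v h - 2 * eps ^+ 2) * expR (x o).
  rewrite -expRD; congr expR; rewrite /overflow_exponent hdeg_cons ve.
  have -> : hoverflow ((e, o) :: h) v = ((o == None) + hoverflow h v)%N.
    by rewrite /hoverflow /= ve.
  by rewrite /x !natrD (_ : true%:R = 1) //; ring.
rewrite (_ : mean _ _ = mean (pr h e) (fun o =>
    expR (overflow_exponent v h - 2 * eps ^+ 2) * expR (x o))); last first.
  by rewrite /mean E; congr (_ + _); apply: eq_bigr => c _; rewrite E.
rewrite meanZ.
apply: (@le_trans _ _ (expR (overflow_exponent v h - 2 * eps ^+ 2) *
    expR (2 * eps ^+ 2))); last first.
  by rewrite -expRD subrK.
rewrite ler_wpM2l ?expR_ge0 //; apply: mean_expR_le => //.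
- move=> o; rewrite /x normrM [`|eps|]ger0_norm // -[leRHS]mulr1 ler_wpM2l //.
  by rewrite ler_norml; case: (o == None); rewrite ?mulr1n ?mulr0n; apply/andP; split; lra.
- lra.
- rewrite /x meanZ; suff H : mean (pr h e) (fun o => (o == None)%:R - 4 * eps) <= 0 by nra.
  rewrite meanD mean_cst /mean /= [X in _ + X - _]big1 => [|c _]; last by rewrite mulr0.
  by rewrite mulr1 addr0; lra.
Qed.

Lemma mean_potential : 0 <= eps -> 4 * eps <= 1 ->
  1 - 4 * eps <= \sum_c pr h e c ->
  mean (pr h e) (fun o => potential ((e, o) :: h)) <= potential h.
Proof.
move=> eps0 eps1 ps; rewrite /potential !meanD; apply: lerD; first apply: lerD.
- rewrite mean_sum ler_sum // => s _; rewrite mean_sum ler_sum // => u _.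
  by rewrite mean_sum ler_sum // => v uv; apply: mean_pair.
- rewrite mean_sum ler_sum // => v _; rewrite mean_sum ler_sum // => U _.
  rewrite mean_sum ler_sum // => K _; rewrite meanZ ler_wpM2l ?expR_ge0 //.
  exact: mean_star.
- by rewrite mean_sum ler_sum // => v _; apply: mean_overflow.
Qed.

End Step.
End Potential.

Lemma sum_expr_card (R : realType) (T : finType) (x : R) :
  \sum_(U : {set T}) x ^+ #|U| = (x + 1) ^+ #|T|.
Proof.
rewrite -cardsT -prodr_const.
rewrite (eq_bigl xpredT) => [|i]; last by rewrite inE.
rewrite bigA_distr /=; apply: eq_big => [U|U _]; first by rewrite inE.
by rewrite -big_mkcond /= prodr_const.
Qed.

Lemma card_neighbors n D (h : history n D) v : (#|neighbors h v| <= hdeg h v)%N.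
Proof.
have -> : hdeg h v = size [seq x : {set 'I_n} <- [seq x.1 | x <- h] | v \in x].
  by rewrite size_filter count_map.
rewrite cardE -(size_map (fun u => [set v; u])); apply: uniq_leq_size.
  rewrite map_inj_in_uniq ?enum_uniq // => x y; rewrite !mem_enum !inE.
  move=> /andP[xv _] _ /setP/(_ x); rewrite !inE eqxx orbT (negbTE xv) /=.
  by move=> /esym/eqP.
move=> e /mapP[u]; rewrite mem_enum inE => /andP[_ ar] ->.
by rewrite mem_filter !inE eqxx /=.
Qed.

Lemma expR_half_le2 (R : realType) : expR (1 / 2) <= 2 :> R.
Proof.
have := @expR_le_quadratic R (1 / 2); rewrite ger0_norm ?lexx; last by lra.
by move=> /(_ isT); rewrite expr2; lra.
Qed.

Lemma expR1_le4 (R : realType) : expR 1 <= 4 :> R.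
Proof.
rewrite [X in expR X](_ : 1 = 2%:R * (1 / 2)); last by field.
rewrite expRM_natl.
rewrite [leRHS](_ : 4 = 2 ^+ 2); last by rewrite expr2; lra.
by rewrite lerXn2r ?nnegrE ?expR_ge0 // expR_half_le2.
Qed.

(** * Initial value of the potential and comparison with its single terms *)

Section PotentialBounds.
Variables (R : realType) (n D : nat) (a B lam eps L : R).
Implicit Types (h : history n D).

Notation potential := (@potential R n D a B lam eps L).

(** All exponents start at [0], and the three sums are at most [2 n^2], [4 n] and [n]. In the second
    one the sets [K] give [(2 / e)^D <= 1] and the sets [U] give [(1 + 1 / n)^n <= 4]. *)
Lemma potential_nil : (2 <= n)%N -> expR L = n%:R -> potential [::] <= expR (5%:R * L).
Proof.
move=> n2 nL; rewrite /potential.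
have n0 : 2 <= n%:R :> R by rewrite ler_nat.
have E1 s u v : pair_exponent a B lam s u v ([::] : history n D) = 0.
  rewrite /pair_exponent /= mulr0 subr0 mulr1 sumr_const card_ord.
  by rewrite -[_ *+ D]/(D%:R) subrr mulr0.
have E2 v U K : star_exponent a B lam v U K ([::] : history n D) = 0.
  rewrite /star_exponent /= subrr big1 => [|c _]; last by rewrite big1.
  by rewrite big1 // !mulr0 subr0.
have E3 v : overflow_exponent eps v ([::] : history n D) = 0.
  by rewrite /overflow_exponent /= !mulr0n; ring.
under eq_bigr do under eq_bigr do under eq_bigr do rewrite E1 expR0.
under [X in _ + X + _]eq_bigr do under eq_bigr do under eq_bigr do
  rewrite E2 expR0 mulr1 expRD.
under [X in _ + X]eq_bigr do rewrite E3 expR0.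
have S1 : \sum_(s : bool) \sum_(u < n) \sum_(v < n | u != v) (1 : R) <= 2 * n%:R ^+ 2.
  apply: (@le_trans _ _ (\sum_(s : bool) \sum_(u < n) n%:R)).
    apply: ler_sum => s _; apply: ler_sum => u _.
    by rewrite sumr_const ler_nat (leq_trans (max_card _)) ?card_ord.
  rewrite big_bool sumr_const card_ord -[n%:R *+ n]mulr_natl expr2.
  by rewrite mulrDl mul1r lexx.
have S2 : \sum_(v < n) \sum_(U : {set 'I_n}) \sum_(K : {set 'I_D})
    expR (- (#|U|%:R * L)) * expR (- D%:R) <= n%:R * 4.
  rewrite sumr_const card_ord -[leLHS]mulr_natl ler_wpM2l //.
  apply: (@le_trans _ _ (\sum_(U : {set 'I_n}) (n%:R^-1) ^+ #|U|)).
    apply: ler_sum => U _; rewrite -mulr_sumr -[leRHS]mulr1.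
    rewrite expRN expRM_natl nL exprVn ler_wpM2l ?invr_ge0 ?exprn_ge0 //.
    have -> : \sum_(K : {set 'I_D}) expR (- D%:R) = 2 ^+ D * expR (- D%:R) :> R.
      rewrite (eq_bigr (fun K : {set 'I_D} => 1 ^+ #|K| * expR (- D%:R))) => [|K _].
        by rewrite -mulr_suml sum_expr_card card_ord.
      by rewrite expr1n mul1r.
    rewrite expRN ler_pdivrMr ?expR_gt0 // mul1r -[D%:R]mulr1 expRM_natl.
    rewrite lerXn2r ?nnegrE ?expR_ge0 //.
    by have := @expR_ge1Dx R 1.
  rewrite sum_expr_card card_ord; apply: le_trans (expR1_le4 R).
  rewrite [X in expR X](_ : 1 = n%:R * n%:R^-1); last by rewrite divff //; lra.
  rewrite expRM_natl lerXn2r ?nnegrE ?expR_ge0 ?addr_ge0 ?invr_ge0 //.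
  by rewrite addrC expR_ge1Dx.
have S3 : \sum_(v < n) (1 : R) = n%:R by rewrite sumr_const card_ord.
rewrite S3; apply: (@le_trans _ _ (2 * n%:R ^+ 2 + n%:R * 4 + n%:R)).
  by rewrite !lerD.
rewrite expRM_natl nL; move: n0; move: (n%:R : R) => x x2.
have : 8 <= x ^+ 3 by rewrite !exprS expr0; nra.
rewrite (_ : x ^+ 5 = x ^+ 2 * x ^+ 3); last by rewrite -exprD.
have : 2 * x <= x ^+ 2 by rewrite expr2; nra.
move: (x ^+ 2) (x ^+ 3) => y z; nra.
Qed.

Lemma le_sum_term (I : finType) (P : pred I) (F : I -> R) i :
  P i -> (forall j, 0 <= F j) -> F i <= \sum_(j | P j) F j.
Proof.
move=> Pi F0; rewrite (bigD1 i) //= lerDl; apply: sumr_ge0 => j _; exact: F0.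
Qed.

Lemma pair_le_potential h s u v : u != v ->
  expR (pair_exponent a B lam s u v h) <= potential h.
Proof.
move=> uv; rewrite /potential -addrA; apply: ler_wpDr.
  rewrite addr_ge0 // sumr_ge0 // => ? _; rewrite ?expR_ge0 //.
  by do 2 (rewrite sumr_ge0 // => ? _); rewrite mulr_ge0 ?expR_ge0.
have g0 s' u' : 0 <= \sum_(v | u' != v) expR (pair_exponent a B lam s' u' v h).
  by apply: sumr_ge0 => ? _; rewrite expR_ge0.
apply: le_trans (@le_sum_term _ xpredT _ s isT _); last first.
  by move=> s'; apply: sumr_ge0 => u' _; apply: g0.
apply: le_trans (@le_sum_term _ xpredT _ u isT _); last by move=> u'; apply: g0.
by apply: (@le_sum_term _ (fun v => u != v)) => // v'; apply: expR_ge0.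
Qed.

Lemma star_le_potential h v (U : {set 'I_n}) (K : {set 'I_D}) :
  expR (- (#|U|%:R * L) - D%:R + star_exponent a B lam v U K h) <= potential h.
Proof.
rewrite expRD /potential; apply: ler_wpDr.
  by apply: sumr_ge0 => ? _; rewrite expR_ge0.
apply: ler_wpDl.
  by do 3 (apply: sumr_ge0 => ? _); rewrite expR_ge0.
have t0 v' (U' : {set 'I_n}) (K' : {set 'I_D}) : 0 <= expR (- (#|U'|%:R * L) - D%:R) *
    expR (star_exponent a B lam v' U' K' h) by rewrite mulr_ge0 ?expR_ge0.
apply: le_trans (@le_sum_term _ xpredT _ v isT _); last first.
  by move=> v'; do 2 (apply: sumr_ge0 => ? _); apply: t0.
apply: le_trans (@le_sum_term _ xpredT _ U isT _); last first.
  by move=> U'; apply: sumr_ge0 => ? _; apply: t0.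
by apply: (@le_sum_term _ xpredT) => // K'; apply: t0.
Qed.

Lemma overflow_le_potential h v :
  expR (overflow_exponent eps v h) <= potential h.
Proof.
rewrite /potential; apply: ler_wpDl; last first.
  by apply: (@le_sum_term _ xpredT) => // ?; apply: expR_ge0.
rewrite addr_ge0 //; first by do 3 (apply: sumr_ge0 => ? _); rewrite expR_ge0.
by do 3 (apply: sumr_ge0 => ? _); rewrite mulr_ge0 ?expR_ge0.
Qed.

End PotentialBounds.

(** * Consequences of a small potential *)

Section Invariants.
Variables (R : realType) (n D : nat) (lam eps L : R).

Definition rate : R := (1 - eps) / D%:R.
(** Chosen so that [cap * (eps / 2) = 1]: a heavier color forces [rate] times the sum of its
    neighbors' stopped weights to be at least [1 - eps / 2]. *)
Definition cap : R := 2 / eps.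

Hypothesis D_gt0 : (0 < D)%N.
Hypothesis eps_gt0 : 0 < eps.
Hypothesis eps_le : eps <= 1 / 4.
Hypothesis lam_gt0 : 0 < lam.
Hypothesis L_ge : 1 / 2 <= L.
Hypothesis rate_cap : 2 * rate * cap ^+ 2 <= 1.
Hypothesis lam_cap : 24 * lam * cap ^+ 2 <= 1.
Hypothesis pair_budget : 5 * L + 2 * tau cap lam * D%:R < lam * eps * D%:R.
Hypothesis star_budget : 8 * L * D%:R + tau cap lam * D%:R ^+ 2 <
  lam * (eps ^+ 3 / 32 * D%:R) * (D%:R * (eps / 2)).
Hypothesis overflow_budget : 5 * L <= eps ^+ 2 * D%:R.

Variable h : history n D.
Hypothesis h_valid : valid_history h.
Hypothesis h_uniq : uniq [seq x.1 | x <- h].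
Hypothesis h_deg : forall v, (hdeg h v <= D)%N.
Hypothesis h_potential : potential rate cap lam eps L h <= expR (5%:R * L).

Notation weight := (weight rate cap h).
Notation pr := (pr rate cap h).

Let D0 : 0 < D%:R :> R. Proof. by rewrite ltr0n. Qed.

Let rate_gt0 : 0 < rate.
Proof. by rewrite divr_gt0 //; move: eps_le; lra. Qed.

Let cap_ge1 : 1 <= cap.
Proof. by rewrite /cap ler_pdivlMr //; move: eps_le; lra. Qed.

Let tau_ge0 : 0 <= tau cap lam.
Proof. by rewrite mulr_ge0 // sqr_ge0. Qed.

Let w0 u c : 0 <= weight u c.
Proof. by have /andP[] := weight_bounds (ltW rate_gt0) cap_ge1 rate_cap u c h_valid. Qed.

Let w2 u c : weight u c <= 2 * cap.
Proof. by have /andP[] := weight_bounds (ltW rate_gt0) cap_ge1 rate_cap u c h_valid. Qed.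

(** Before [uv] arrives the stopped weights are the current ones, so the two signs of
    [pair_exponent] give the two sides; the charge is at most [2 * tau * D]. *)
Lemma sum_weights_dist u v : u != v -> ~~ arrived h u v ->
  `|\sum_c weight u c * weight v c - D%:R| <= eps * D%:R.
Proof.
move=> uv nar; set S := \sum_c _.
have nar' : ~~ arrived h v u by rewrite /arrived setUC.
have H (s : bool) : (-1) ^+ s * lam * (S - D%:R) < lam * eps * D%:R.
  have := le_trans (pair_le_potential rate cap lam eps L h s uv) h_potential.
  rewrite ler_expR /pair_exponent.
  rewrite (eq_bigr (fun c => weight u c * weight v c)) => [|c _]; last first.
    by rewrite !stopped_weight.
  rewrite -/S => H.
  have dd : tau cap lam * (hdeg h u + hdeg h v)%:R <= tau cap lam * (2 * D%:R).
    by rewrite ler_wpM2l // natrD mulrDl mul1r lerD // ler_nat.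
  by move: H dd pair_budget; lra.
have /= := H true; have /= := H false; rewrite expr0 expr1 mul1r !mulN1r mulNr.
rewrite -!mulrA -mulrN !ltr_pM2l // => H1 H2.
by rewrite ler_norml; apply/andP; split; lra.
Qed.

Definition dead v : {set 'I_D} := [set c | cap < weight v c].

(** The potential has a term for the actual neighbors [U] and dead colors [K]. By [weight_neighbors]
    each dead color has excess at least [D * (eps / 2)] over [U]; too many of them would violate
    [star_budget]. *)
Lemma card_dead v : #|dead v|%:R <= eps ^+ 3 / 32 * D%:R.
Proof.
rewrite leNgt; apply/negP => big.
set U := neighbors h v; set K := dead v.
have U_le : (#|U| <= D)%N := leq_trans (card_neighbors h v) (h_deg v).
have := le_trans (star_le_potential rate cap lam eps L h v U K) h_potential.
rewrite ler_expR /star_exponent => H.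
have S_ge : #|K|%:R * (D%:R * (eps / 2)) <=
    \sum_(c in K) \sum_(u in U) (stopped rate cap h v u c - 1).
  rewrite mulr_natl -sumr_const; apply: ler_sum => c; rewrite inE => cK.
  rewrite sumrB sumr_const.
  have := weight_neighbors (ltW rate_gt0) cap_ge1 rate_cap v c h_valid h_uniq.
  set s := \sum_(u in _) _ => Hs.
  have s_ge : 1 - eps / 2 <= rate * s.
    rewrite leNgt; apply/negP => s_lt.
    have : 1 < weight v c * (1 - rate * s).
      have E : cap * (eps / 2) = 1 by rewrite /cap; field; rewrite gt_eqF.
      rewrite -[ltLHS]E.
      by rewrite ltr_pM //; move: eps_gt0 cap_ge1; lra.
    by rewrite ltNge Hs.
  (* This uses [(1 - eps) * (1 + eps / 2) <= 1 - eps / 2]. *)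
  have : D%:R * (1 + eps / 2) <= s.
    move: s_ge; rewrite /rate mulrAC ler_pdivlMr // => s_ge.
    have e1 : 0 < 1 - eps by move: eps_le; lra.
    rewrite -(ler_pM2l e1); apply: le_trans s_ge.
    have := mulr_ge0 (ltW D0) (sqr_ge0 eps); rewrite expr2; lra.
  have : #|U|%:R <= D%:R :> R by rewrite ler_nat.
  lra.
have deg_le : tau cap lam * (\sum_(u in U) hdeg h u)%:R <= tau cap lam * D%:R ^+ 2.
  rewrite ler_wpM2l // -natrX ler_nat.
  apply: (@leq_trans (\sum_(u in U) D)); first exact: leq_sum.
  by rewrite sum_nat_const leq_mul2r U_le orbT.
(* The [8] of [star_budget] is [5 + 1 + 2]: the bound on the potential, the union bound over [U] and
   the one over [K], each in units of [D * L]. *)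
have UL : #|U|%:R * L <= D%:R * L.
  by rewrite ler_wpM2r ?ler_nat //; move: L_ge; lra.
have D1 : 1 <= D%:R :> R by rewrite ler1n.
have LD : L <= D%:R * L by rewrite ler_peMl //; move: L_ge; lra.
have DL : D%:R <= 2 * (D%:R * L).
  by rewrite mulrCA ler_peMr //; move: L_ge; lra.
have KK : lam * (eps ^+ 3 / 32 * D%:R) * (D%:R * (eps / 2)) <=
    lam * (#|K|%:R * (D%:R * (eps / 2))).
  rewrite -mulrA ler_wpM2l ?(ltW lam_gt0) // ler_wpM2r ?(ltW big) //.
  by rewrite mulr_ge0 // ltW // divr_gt0.
have := ler_wpM2l (ltW lam_gt0) S_ge.
move: star_budget KK H deg_le UL LD DL; lra.
Qed.

(** The capped sum lies between [(1 - 2 * eps) * D] and [(1 + eps) * D]; the factor [1 - eps] in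
    [rate] brings the upper bound below [1]. *)
Lemma sum_pr_bounds u v : u != v -> ~~ arrived h u v ->
  1 - 4 * eps <= \sum_c pr [set u; v] c <= 1.
Proof.
move=> uv nar; have := sum_weights_dist uv nar; set S := \sum_c _.
rewrite ler_norml => /andP[S1 S2].
rewrite (eq_bigr _ (fun c _ => pr_pair rate cap h c uv)) -mulr_sumr.
set C := \sum_c _.
have CS : C <= S.
  by apply: ler_sum => c _; rewrite ler_pM ?capped_ge0 ?capped_id.
have SC : S - 4 * cap ^+ 2 * (#|dead u|%:R + #|dead v|%:R) <= C.
  have -> : #|dead u|%:R + #|dead v|%:R =
      \sum_c ((c \in dead u)%:R + (c \in dead v)%:R) :> R.
    have cardE (K : {set 'I_D}) : #|K|%:R = \sum_c (c \in K)%:R :> R.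
      rewrite -sum1_card natr_sum big_mkcond; apply: eq_bigr => c _.
      by case: (c \in K).
    by rewrite !cardE -big_split.
  rewrite mulr_sumr -sumrB; apply: ler_sum => c _; rewrite !inE /capped.
  have xy : weight u c * weight v c <= (2 * cap) * (2 * cap) by rewrite ler_pM.
  have := mulr_ge0 (w0 u c) (w0 v c); have := sqr_ge0 cap.
  move: xy; move: (w0 u c) (w0 v c); rewrite expr2.
  by case: leP => _; case: leP => _ ? ? ? ? ? /=; rewrite ?mulr0n ?mulr1n; lra.
have du := card_dead u; have dv := card_dead v.
(* A dead color loses at most [(2 * cap) ^+ 2]; the constant [32] in [card_dead] makes the total
   loss exactly affordable. *)
have capE : 4 * cap ^+ 2 * (#|dead u|%:R + #|dead v|%:R) <= eps * D%:R.
  apply: (@le_trans _ _ (4 * cap ^+ 2 * (eps ^+ 3 / 16 * D%:R))).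
    by apply: ler_wpM2l; [apply: mulr_ge0; rewrite ?sqr_ge0|lra].
  rewrite le_eqVlt; apply/orP; left; apply/eqP; rewrite /cap; field.
  by rewrite gt_eqF.
have rD : rate * D%:R = 1 - eps by rewrite /rate divfK ?gt_eqF.
apply/andP; split.
  apply: (@le_trans _ _ (rate * ((1 - 2 * eps) * D%:R))); last first.
    by rewrite ler_wpM2l ?(ltW rate_gt0) //; lra.
  rewrite mulrCA rD; have := sqr_ge0 eps; rewrite expr2; move: eps_gt0; lra.
apply: (@le_trans _ _ (rate * ((1 + eps) * D%:R))).
  by rewrite ler_wpM2l ?(ltW rate_gt0) //; lra.
rewrite mulrCA rD; have := sqr_ge0 eps; rewrite expr2; lra.
Qed.

(** Here [7 = 4 + 2 + 1]: the mean, the second-order charge and the bound [5 * L] on the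
    exponent. *)
Lemma hoverflow_le v : (hoverflow h v)%:R <= 7 * eps * D%:R.
Proof.
have := le_trans (overflow_le_potential rate cap lam eps L h v) h_potential.
rewrite ler_expR /overflow_exponent => H.
have dD : eps ^+ 2 * (hdeg h v)%:R <= eps ^+ 2 * D%:R.
  by rewrite ler_wpM2l ?sqr_ge0 // ler_nat.
rewrite -(ler_pM2l eps_gt0); move: H dD overflow_budget; rewrite expr2; lra.
Qed.

Lemma potential_decreases (e : {set 'I_n}) : #|e| = 2%N -> e \notin [seq x.1 | x <- h] ->
  mean (pr e) (fun o => potential rate cap lam eps L ((e, o) :: h))
  <= potential rate cap lam eps L h /\ \sum_c pr e c <= 1.
Proof.
move=> e2 eh; have /cards2P[u [v [uv eE]]] : #|e| == 2%N by rewrite e2.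
have nar : ~~ arrived h u v by rewrite /arrived -eE.
have /andP[p1 p2] := sum_pr_bounds uv nar; rewrite -eE in p1 p2.
split=> //; apply: mean_potential => //; try exact: ltW.
by move: eps_le; lra.
Qed.

End Invariants.

(** * The algorithm *)

(** Pigeonhole: the [size s + 1] candidates cannot all lie in [s]. *)
Lemma find_fresh (D : nat) (s : seq nat) :
  let i := find (fun i => (D + i)%N \notin s) (iota 0 (size s).+1) in
  (i <= size s)%N /\ (D + i)%N \notin s.
Proof.
set p := fun _ => _; move=> i.
have hp : has p (iota 0 (size s).+1).
  apply/negPn/negP => /hasPn np.
  have : (size [seq (D + i)%N | i <- iota 0 (size s).+1] <= size s)%N.
    apply: uniq_leq_size; first by rewrite map_inj_uniq ?iota_uniq //; apply: addnI.
    by move=> x /mapP[j jI ->]; have := np j jI; rewrite /p negbK.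
  by rewrite size_map size_iota ltnn.
have iI : (i < (size s).+1)%N by move: hp; rewrite has_find size_iota.
by split=> //; have := nth_find 0%N hp; rewrite -/i nth_iota.
Qed.

(** * Plays against a legal adversary *)

Section Game.
Variables (R : realType) (n : nat) (A : online_algorithm R n) (adv : adversary A).
Variable Delta : nat.
Hypothesis adv_legal : legal_adversary Delta adv.

Lemma law_gt0_exists t e : exists r, 0 < law (o := A) t e r.
Proof.
have [/existsP//|/existsPn np] := boolP [exists r, 0 < law (o := A) t e r].
have := law_sum1 (o := A) t e; rewrite big1 => [/eqP|r _].
  by rewrite eq_sym oner_eq0.
by apply/eqP; rewrite eq_le law_ge0 leNgt np.
Qed.

Lemma play_size t : play adv t -> (size t <= #|{: edge n}|)%N.
Proof.
move=> /(proj1 adv_legal) u; rewrite -(size_map (fun x => x.1.1)) -/(edges t).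
by rewrite -(card_uniqP u) max_card.
Qed.

(** Legality speaks of the degree at the end only. Every play extends to a complete one, by
    induction on the number of rounds that can remain, and degrees only grow. *)
Lemma play_degree t v : play adv t -> (degree (edges t) v <= Delta)%N.
Proof.
move: {-1}(_ - size t)%N (leqnn (#|{: edge n}| - size t)) => k.
elim: k t => [|k IH] t kt pt; case E: (adv t) => [e|].
- have [r r0] := law_gt0_exists t e; have := play_size (play_extend pt E r0).
  by rewrite size_rcons => lt; move: kt; rewrite leqn0 subn_eq0 leqNgt lt.
- by rewrite -(proj2 adv_legal t) // /max_degree; apply: (leq_bigmax v).
- have [r r0] := law_gt0_exists t e; have pt' := play_extend pt E r0.
  apply: leq_trans (IH _ _ pt').
    by rewrite /edges map_rcons /degree -cats1 count_cat leq_addr.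
  by rewrite size_rcons subnS; move: kt; case: (_ - _)%N.
- by rewrite -(proj2 adv_legal t) // /max_degree; apply: (leq_bigmax v).
Qed.

(** The remaining fuel plus the rounds played is at least the number of edges, so the fuel cannot
    run out before the adversary stops. *)
Lemma prob_eq1 (P : pred (transcript n (coin A))) :
  (forall t, complete_play adv t -> P t) -> prob adv P = 1.
Proof.
move=> HP; rewrite /prob.
have : (#|{: edge n}| <= #|{: edge n}| + size ([::] : transcript n (coin A)))%N by rewrite addn0.
have : play adv [::] by apply: play_nil.
elim: {2 3}#|_| [::] => [|k IH] t pt kt.
  rewrite /= HP //; split=> //; case E: (adv t) => [e|] //.
  have [r r0] := law_gt0_exists t e; have := play_size (play_extend pt E r0).
  by rewrite size_rcons ltnNge -[size t]add0n kt.
rewrite /=; case E: (adv t) => [e|]; last by rewrite HP.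
rewrite -[RHS](law_sum1 (o := A) t e); apply: eq_bigr => r _.
have := law_ge0 (o := A) t e r; rewrite le0r => /orP[/eqP ->|r0]; first by rewrite mul0r.
by rewrite IH ?mulr1 //; [apply: play_extend|rewrite size_rcons addnS -addSn].
Qed.

End Game.

(** * The derandomized algorithm and its analysis *)

Section Algorithm.
Variables (R : realType) (n D : nat) (lam eps L : R).
Implicit Types (h : history n D) (t : transcript n unit) (e : edge n).

Local Notation pot := (potential (rate D eps) (cap eps) lam eps L).

(** Reversed because histories list the latest round first; [insub] turns every spare color, being
    at least [D], into [None]. *)
Definition hist t : history n D := rev [seq (val x.1.1, insub x.2) | x <- t].

Definition allowed h (e : {set 'I_n}) (o : option 'I_D) : bool :=
  if o is Some c then pr (rate D eps) (cap eps) h e c != 0 else true.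

Definition choice h (e : {set 'I_n}) : option 'I_D :=
  [arg min_(o < None | allowed h e o) pot ((e, o) :: h)]%O.

Definition clash t e : seq nat :=
  [seq x.2 | x <- t & share_endpoint x.1.1 e && (D <= x.2)%N].

Definition spare_color t e : nat :=
  D + find (fun i => (D + i)%N \notin clash t e) (iota 0 (size (clash t e)).+1).

Definition choice_color t e (r : unit) : nat :=
  if choice (hist t) (val e) is Some c then val c else spare_color t e.

(** The coin is [unit]: the algorithm is deterministic. *)
Definition choice_algorithm : online_algorithm R n.
Proof.
refine (@OnlineAlgorithm R n unit (fun _ _ _ => 1) _ _ choice_color).
- by move=> *; apply: ler01.
- by move=> *; rewrite sumr_const card_unit.
Defined.

Lemma spare_colorP t e :
  [/\ (D <= spare_color t e)%N, (spare_color t e <= D + size (clash t e))%N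
    & spare_color t e \notin clash t e].
Proof.
have [? ?] := find_fresh D (clash t e).
by split; rewrite // ?leq_addr // leq_add2l.
Qed.

Lemma hist_rcons t e r k : hist (rcons t (e, r, k)) = (val e, insub k) :: hist t.
Proof. by rewrite /hist map_rcons rev_rcons. Qed.

Lemma hist_extend t e r :
  hist (@extend R n choice_algorithm t e r) =
  (val e, choice (hist t) (val e)) :: hist t.
Proof.
rewrite /extend hist_rcons /= /choice_color; case: choice => [c|]; first by rewrite valK.
by rewrite insubN // -leqNgt; have [] := spare_colorP t e.
Qed.

Lemma allowed_choice h (e : {set 'I_n}) : allowed h e (choice h e).
Proof. by rewrite /choice; case: arg_minP. Qed.

Lemma hist_valid t : valid_history (hist t).
Proof.
rewrite /valid_history all_rev all_map; apply/allP => x _ /=; exact: (valP x.1.1).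
Qed.

Lemma hist_edges t : [seq x.1 | x <- hist t] = rev (map val (edges t)).
Proof. by rewrite /hist /edges map_rev -!map_comp. Qed.

Lemma hist_deg t v : hdeg (hist t) v = degree (edges t) v.
Proof. by rewrite /hdeg /hist count_rev count_map /degree /edges count_map. Qed.

Lemma hist_overflow t v : hoverflow (hist t) v =
  count (fun x : round n unit => (v \in val x.1.1) && (D <= x.2)%N) t.
Proof.
rewrite /hoverflow /hist count_rev count_map; apply: eq_count => x /=.
by case: insubP => [c ltD _|/negbTE ltD]; rewrite leqNgt ltD.
Qed.

Lemma share_endpointP (e f : edge n) :
  reflect (exists2 v, v \in val e & v \in val f) (share_endpoint e f).
Proof.
rewrite /share_endpoint; apply: (iffP (set0Pn _)) => [[v]|[v ve vf]].
  by rewrite inE => /andP[]; exists v.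
by exists v; rewrite inE ve.
Qed.

(** Each clashing edge is an overflow edge at one of the two endpoints of [e]. *)
Lemma size_clash t e m : (forall v, hoverflow (hist t) v <= m)%N ->
  (size (clash t e) <= 2 * m)%N.
Proof.
move=> mv; have /cards2P[u [v [_ eE]]] := valP e.
rewrite size_map size_filter; pose q w (x : round n unit) := (w \in val x.1.1) && (D <= x.2)%N.
apply: (@leq_trans (count (predU (q u) (q v)) t)).
  apply: sub_count => x /= /andP[/share_endpointP[w wx]].
  by rewrite eE !inE /q => /orP[] /eqP <- ->; rewrite wx ?orbT.
apply: (@leq_trans (count (q u) t + count (q v) t)).
  by rewrite -count_predUI leq_addr.
by rewrite mul2n -addnn leq_add // -hist_overflow.
Qed.

(** A main color is safe by [pr_used], a spare one because [clash] lists the spare colors of all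
    adjacent edges. *)
Lemma color_fresh t e r x : x \in t -> share_endpoint x.1.1 e ->
  x.2 != choice_color t e r.
Proof.
move=> xt xe; rewrite /choice_color.
have := allowed_choice (hist t) (val e); case: choice => [c /= pc|_].
  apply: contra pc => /eqP xc; apply/eqP.
  have /share_endpointP[v vx ve] := xe.
  apply: (@pr_used _ _ _ _ _ _ _ (val x.1.1) v) => //.
  by rewrite mem_rev; apply/mapP; exists x; rewrite // xc valK.
have [ge _] := spare_colorP t e; apply: contra => /eqP xc.
rewrite -xc; apply/mapP; exists x => //; by rewrite mem_filter xe xt xc ge.
Qed.

Variable adv : adversary choice_algorithm.

Lemma play_proper t : play adv t -> proper_coloring t.
Proof.
elim=> [|{}t e r pt IH _ _] x y //; rewrite !mem_rcons !inE.
move=> /orP[/eqP ->|xt] /orP[/eqP ->|yt] //=; first by rewrite eqxx.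
- move=> _; rewrite /share_endpoint setIC -/(share_endpoint _ _) eq_sym.
  exact: color_fresh.
- by move=> _; apply: color_fresh.
- exact: IH.
Qed.

Lemma play_colors t m : play adv t ->
  (forall v, hoverflow (hist t) v <= m)%N ->
  forall x, x \in t -> (x.2 < D + 2 * m + 1)%N.
Proof.
elim=> [|{}t e r pt IH _ _] // mv x; rewrite mem_rcons inE => /orP[/eqP ->|xt]; last first.
  apply: IH => // v; apply: leq_trans (mv v); rewrite hist_extend.
  by rewrite /hoverflow /= leq_addl.
have mv' v : (hoverflow (hist t) v <= m)%N.
  by apply: leq_trans (mv v); rewrite hist_extend /hoverflow /= leq_addl.
rewrite /= /choice_color addn1 ltnS; case: choice => [c|].
  by rewrite (leq_trans (ltnW (ltn_ord c))) // leq_addr.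
have [_ le _] := spare_colorP t e; apply: leq_trans le _.
by rewrite leq_add2l size_clash.
Qed.

Lemma play_num_colors t m : play adv t ->
  (forall v, hoverflow (hist t) v <= m)%N ->
  (num_colors t <= D + 2 * m + 1)%N.
Proof.
move=> pt mv; rewrite -[leqRHS](size_iota 0); apply: uniq_leq_size.
  exact: undup_uniq.
move=> k; rewrite mem_undup => /mapP[x xt ->]; rewrite mem_iota /= add0n.
exact: play_colors xt.
Qed.

Hypothesis adv_legal : legal_adversary D adv.

Lemma play_hist_deg t v : play adv t -> (hdeg (hist t) v <= D)%N.
Proof. by move=> pt; rewrite hist_deg; apply: (play_degree adv_legal v pt). Qed.

Lemma play_hist_uniq t : play adv t -> uniq [seq x.1 | x <- hist t].
Proof.
move=> pt; rewrite hist_edges rev_uniq map_inj_uniq; last exact: val_inj.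
exact: (proj1 adv_legal).
Qed.

Hypothesis D_gt0 : (0 < D)%N.
Hypothesis n_ge2 : (2 <= n)%N.
Hypothesis L_ln : L = ln n%:R.
Hypothesis eps_gt0 : 0 < eps.
Hypothesis eps_le : eps <= 1 / 4.
Hypothesis lam_gt0 : 0 < lam.
Hypothesis L_ge : 1 / 2 <= L.
Hypothesis rate_cap : 2 * rate D eps * cap eps ^+ 2 <= 1.
Hypothesis lam_cap : 24 * lam * cap eps ^+ 2 <= 1.
Hypothesis pair_budget :
  5 * L + 2 * tau (cap eps) lam * D%:R < lam * eps * D%:R.
Hypothesis star_budget : 8 * L * D%:R + tau (cap eps) lam * D%:R ^+ 2 <
  lam * (eps ^+ 3 / 32 * D%:R) * (D%:R * (eps / 2)).
Hypothesis overflow_budget : 5 * L <= eps ^+ 2 * D%:R.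

(** The bound at [t] provides the invariants that make the mean of the next potential no larger; the
    minimizing choice stays below that mean. *)
Lemma play_potential t : play adv t -> pot (hist t) <= expR (5%:R * L).
Proof.
elim=> [|{}t e r pt IH Et lt].
  by apply: potential_nil; rewrite // L_ln lnK // posrE ltr0n (leq_trans _ n_ge2).
have pt' := play_extend pt Et lt.
have := play_hist_uniq pt'; rewrite hist_extend => /andP[eh hu].
have e2 : #|val e| = 2%N by apply/eqP/(valP e).
have hd v := play_hist_deg v pt.
have [mp ps] := potential_decreases D_gt0 eps_gt0 eps_le lam_gt0 L_ge rate_cap
  lam_cap pair_budget star_budget (hist_valid t) hu hd IH e2 eh.
apply: le_trans (le_trans mp IH); apply: le_mean => //.
- move=> c; apply: pr_ge0 => //; last exact: hist_valid.
    by rewrite divr_ge0 //; move: eps_le; lra.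
  by rewrite /cap ler_pdivlMr //; move: eps_le; lra.
(* [None] is always allowed, whatever its probability. *)
- by rewrite /choice; case: arg_minP => // o _ /(_ None); apply.
- by move=> c pc; rewrite /choice; case: arg_minP => // o _ /(_ (Some c)); apply.
Qed.

Lemma play_overflow t v : play adv t ->
  (hoverflow (hist t) v)%:R <= 7 * eps * D%:R.
Proof.
move=> pt; apply: (hoverflow_le (lam := lam) eps_gt0 overflow_budget).
  by move=> w; apply: play_hist_deg.
exact: play_potential.
Qed.

End Algorithm.

(** * Choice of the constants *)

Section Tuning.
Variables (R : realType) (n D : nat).

Definition log_size : R := ln n%:R.
Definition slack : R := 4 * (log_size / D%:R) `^ (1 / 16).
(** The power balances [star_budget]: the charge [tau] is [4608 * lam ^+ 2 / eps ^+ 4], the gain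
    [lam * eps ^+ 4 / 64]. *)
Definition tilt : R := slack ^+ 8 / (1024 * 1024).

Hypothesis n_ge2 : (2 <= n)%N.
Hypothesis D_gt0 : (0 < D)%N.

Lemma log_size_ge : 1 / 2 <= log_size.
Proof.
rewrite -[leLHS]expRK ler_ln ?posrE ?expR_gt0 ?ltr0n ?(leq_trans _ n_ge2) //.
by rewrite (le_trans (expR_half_le2 R)) // ler_nat.
Qed.

Let D0 : 0 < D%:R :> R. Proof. by rewrite ltr0n. Qed.
Let L0 : 0 < log_size. Proof. by have := log_size_ge; lra. Qed.

Lemma slack_gt0 : 0 < slack.
Proof. by rewrite mulr_gt0 // powR_gt0 // divr_gt0. Qed.

Lemma slack_pow : slack ^+ 16 * D%:R = 1024 * 1024 * 1024 * 4 * log_size.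
Proof.
rewrite /slack exprMn -(powR_mulrn 16 (powR_ge0 _ _)) -powRrM.
rewrite (_ : 1 / 16 * 16 = 1); last by field.
rewrite powRr1 ?divr_ge0 ?(ltW L0) //.
by rewrite -[LHS]mulrA divfK ?gt_eqF //; ring.
Qed.

Lemma slack_degree :
  slack * D%:R = 4 * (D%:R `^ (15 / 16)) * (log_size `^ (1 / 16)).
Proof.
rewrite /slack powRM ?invr_ge0 ?(ltW L0) // -!mulrA; congr (_ * _).
rewrite mulrC; congr (_ * _).
rewrite -powR_inv1 // -powRrM -[X in _ * X](powRr1 (ltW D0)) -powRD; last first.
  by apply/implyP => _; rewrite gt_eqF.
by congr (_ `^ _); field.
Qed.

Hypothesis slack_le : slack <= 1 / 4.

Let slack_le1 : slack <= 1. Proof. by move: slack_le; lra. Qed.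

(** With [j = 16] and [slack_pow], every lower power of [slack] times [D] dominates a large multiple
    of [log_size]. *)
Let powD_le i j : (i <= j)%N -> slack ^+ j * D%:R <= slack ^+ i * D%:R.
Proof.
move=> ij; rewrite ler_wpM2r //.
by apply: ler_wiXn2l => //; rewrite ltW ?slack_gt0.
Qed.

Let tauE : tau (cap slack) tilt =
  4608 * slack ^+ 12 / (1024 * 1024 * 1024 * 1024).
Proof. by rewrite /tau /cap /tilt; field; rewrite gt_eqF // slack_gt0. Qed.

Lemma tuned_rate_cap : 2 * rate D slack * cap slack ^+ 2 <= 1.
Proof.
have -> : 2 * rate D slack * cap slack ^+ 2 =
    8 * (1 - slack) / (slack ^+ 2 * D%:R).
  by rewrite /rate /cap; field; rewrite !gt_eqF // slack_gt0.
rewrite ler_pdivrMr; last by rewrite mulr_gt0 // exprn_gt0 // slack_gt0.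
have := @powD_le 2 16 isT; rewrite slack_pow.
by move: slack_gt0 log_size_ge; lra.
Qed.

Lemma tuned_lam_cap : 24 * tilt * cap slack ^+ 2 <= 1.
Proof.
have -> : 24 * tilt * cap slack ^+ 2 = 96 * slack ^+ 6 / (1024 * 1024).
  by rewrite /tilt /cap; field; rewrite gt_eqF // slack_gt0.
have : slack ^+ 6 <= 1 by rewrite exprn_ile1 // ltW ?slack_gt0.
lra.
Qed.

Lemma tuned_pair_budget : 5 * log_size + 2 * tau (cap slack) tilt * D%:R <
  tilt * slack * D%:R.
Proof.
have -> : tilt * slack * D%:R = slack ^+ 9 * D%:R / (1024 * 1024).
  by rewrite /tilt; field.
rewrite tauE.
have := @powD_le 9 16 isT; have := @powD_le 9 12 isT; rewrite slack_pow.
have : 0 < slack ^+ 9 * D%:R by rewrite mulr_gt0 // exprn_gt0 // slack_gt0.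
move: (slack ^+ 9) (slack ^+ 12) => x y; lra.
Qed.

Lemma tuned_star_budget :
  8 * log_size * D%:R + tau (cap slack) tilt * D%:R ^+ 2 <
  tilt * (slack ^+ 3 / 32 * D%:R) * (D%:R * (slack / 2)).
Proof.
have -> : tilt * (slack ^+ 3 / 32 * D%:R) * (D%:R * (slack / 2)) =
    slack ^+ 12 * D%:R * D%:R / (64 * 1024 * 1024) by rewrite /tilt; field.
have := ler_wpM2r (ltW D0) (@powD_le 12 16 isT); rewrite slack_pow tauE expr2.
have : 0 < slack ^+ 12 * D%:R * D%:R by rewrite mulr_gt0 // mulr_gt0 // exprn_gt0 // slack_gt0.
move: (slack ^+ 12) => x; lra.
Qed.

Lemma tuned_overflow_budget : 5 * log_size <= slack ^+ 2 * D%:R.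
Proof. by have := @powD_le 2 16 isT; rewrite slack_pow; move: L0; lra. Qed.

Lemma slack_degree_ge1 : 1 <= slack * D%:R.
Proof.
by have := @powD_le 1 16 isT; rewrite slack_pow expr1; move: log_size_ge; lra.
Qed.

End Tuning.

Theorem theorem3p2 (R : realType) :
  exists C c : R, 0 < C /\ 0 < c /\
  exists A : forall n Delta : nat, online_algorithm R n,
  forall n Delta : nat, (2 <= n)%N -> (1 <= Delta)%N ->
  forall adv : adversary (A n Delta), legal_adversary Delta adv ->
    (forall t, complete_play adv t -> proper_coloring t) /\
    1 - 1 / (n%:R `^ c) <=
      prob adv (fun t => (num_colors t)%:R <=
        Delta%:R + C * (Delta%:R `^ (15 / 16)) * ((ln n%:R) `^ (1 / 16))).
Proof.
(* The excess will be at most [15 * slack * D], and [slack] carries a factor [4]. The success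
   probability is [1], so [c = 1] will do. *)
exists 60, 1; split=> //; split=> //.
exists (fun n D =>
  choice_algorithm n D (tilt R n D) (slack R n D) (log_size R n)).
move=> n D n2 D1 adv adv_legal; split=> [t [pt _]|]; first exact: play_proper pt.
rewrite (prob_eq1 adv_legal) => [|t [pt _]].
  by rewrite gerBl divr_ge0 // powR_ge0.
have -> : 60 * D%:R `^ (15 / 16) * ln n%:R `^ (1 / 16) =
    15 * (slack R n D * D%:R) by rewrite slack_degree // /log_size; ring.
pose m := \max_(v < n) hoverflow (hist D t) v.
have := play_num_colors pt (fun v => leq_bigmax v : _ <= m)%N.
rewrite -(ler_nat R) (natrD _ (_ + _)) natrD natrM => num_le; apply: le_trans num_le _.
have n_card : (0 < #|'I_n|)%N by rewrite card_ord (leq_trans _ n2).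
have [v mE] := @bigop.eq_bigmax 'I_n (hoverflow (hist D t)) n_card.
have m_le_deg : m%:R <= D%:R :> R.
  rewrite ler_nat /m mE (leq_trans _ (play_hist_deg adv_legal v pt)) //.
  by apply: sub_count => x /andP[].
have D1' : 1 <= D%:R :> R by rewrite ler1n.
(* For large [slack] the trivial [m <= D] suffices: [2 * m + 1 <= 3 * D <= 12 * slack * D]. *)
have [slack_le|slack_gt] := leP (slack R n D) (1 / 4); last first.
  have : 1 / 4 * D%:R <= slack R n D * D%:R by rewrite ler_wpM2r // ltW.
  lra.
have : m%:R <= 7 * slack R n D * D%:R.
  rewrite /m mE; apply: (play_overflow adv_legal D1 n2) => //.
  - exact: slack_gt0.
  - by apply: divr_gt0; rewrite ?exprn_gt0 ?slack_gt0 ?mulr_gt0.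
  - exact: log_size_ge.
  - exact: tuned_rate_cap.
  - exact: tuned_lam_cap.
  - exact: tuned_pair_budget.
  - exact: tuned_star_budget.
  - exact: tuned_overflow_budget.
(* The extra color in [2 * m + 1] turns [14] into [15]. *)
have := slack_degree_ge1 n2 D1 slack_le.
lra.
Qed.
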